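(* Let $A=(a_{ij})\in\mathbb{R}^{n\times m}$, let $N=\{1,\dots,n\}$ and $M=\{1,\dots,m\}$. Let $G_R$ be the complete undirected graph on the node set $N$ (the rows of $A$), with edge weights $$\omega^{ME}_{ik}=\sum_{j\in M}a_{ij}a_{kj}\qquad (i,k\in N,\ i\neq k),$$ and let $G_C$ be the complete undirected graph on the node set $M$ (the columns of $A$), with edge weights $$\tau^{ME}_{j\ell}=\sum_{i\in N}a_{ij}a_{i\ell}\qquad (j,\ell\in M,\ j\neq \ell).$$ Then the maximization of the measure of effectiveness over all reorderings of the rows and columns of $A$ is equivalent to finding two maximum weight Hamiltonian paths, one in $(G_R,\omega^{ME})$ and one in $(G_C,\tau^{ME})$. That is, a pair of permutations $(\sigma_r,\sigma_c)\in\mathcal{P}_n\times\mathcal{P}_m$ maximizes $\mathrm{ME}(A_{\sigma_r,\sigma_c})$ over $\mathcal{P}_n\times\mathcal{P}_m$ if and only if the Hamiltonian path induced by $\sigma_r$ has maximum weight among all Hamiltonian paths of $(G_R,\omega^{ME})$ and the Hamiltonian path induced by $\sigma_c$ has maximum weight among all Hamiltonian paths of $(G_C,\tau^{ME})$.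
   Context: $\mathcal{P}_n$ and $\mathcal{P}_m$ denote the sets of permutations of $N=\{1,\dots,n\}$ and $M=\{1,\dots,m\}$. For $\sigma_r\in\mathcal{P}_n$ and $\sigma_c\in\mathcal{P}_m$, $\sigma_r(i)=k$ means that row $i$ of $A$ is placed in position $k$, and $\sigma_c(j)=\ell$ means that column $j$ of $A$ is placed in position $\ell$. The reordered matrix $A_{\sigma_r,\sigma_c}$ is the $n\times m$ matrix whose entry in position $(\sigma_r(i),\sigma_c(j))$ is $a_{ij}$. The row and column permutations are chosen independently. The measure of effectiveness of a matrix $B=(b_{k\ell})\in\mathbb{R}^{n\times m}$ is $$\mathrm{ME}(B)=\frac12\sum_{k\in N}\sum_{\ell\in M}b_{k\ell}\,(b_{k,\ell+1}+b_{k,\ell-1})+\sum_{k\in N}\sum_{\ell\in M}b_{k\ell}\,(b_{k+1,\ell}+b_{k-1,\ell}),$$ where entries with an index outside $N\times M$ are taken to be $0$. A Hamiltonian path in a graph is a path visiting every vertex exactly once; its weight is the sum of the weights of its edges. The Hamiltonian path induced by a permutation $\sigma$ of $\{1,\dots,s\}$ is the path visiting the nodes in the order $\sigma^{-1}(1),\sigma^{-1}(2),\dots,\sigma^{-1}(s)$. *)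

(* Defs.v *)
From mathcomp Require Import all_boot all_order all_fingroup all_algebra.
From mathcomp Require Import reals.

Set Implicit Arguments.
Unset Strict Implicit.
Unset Printing Implicit Defensive.

Import Order.TTheory GRing.Theory Num.Theory.
Local Open Scope ring_scope.

(* [row_perm s A] moves row [s i] to position [i], hence the inverses: row [i]
   of [A] must land in position [sr i] and column [j] in position [sc j]. *)
Definition reorder (R : Type) (n m : nat) (A : 'M[R]_(n, m))
    (sr : 'S_n) (sc : 'S_m) : 'M[R]_(n, m) :=
  row_perm (sr^-1)%g (col_perm (sc^-1)%g A).

Lemma reorderE (R : Type) (n m : nat) (A : 'M[R]_(n, m))
    (sr : 'S_n) (sc : 'S_m) (i : 'I_n) (j : 'I_m) :
  reorder A sr sc (sr i) (sc j) = A i j.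
Proof. by rewrite !mxE !permK. Qed.

(* Extension of [B] by zero. The indices are integers because the index
   [k - 1] must fall outside the matrix when [k = 0]. *)
Definition entry (R : nmodType) (n m : nat) (B : 'M[R]_(n, m))
    (k l : int) : R :=
  match k, l with
  | Posz k', Posz l' =>
      match (insub k' : option 'I_n), (insub l' : option 'I_m) with
      | Some i, Some j => B i j
      | _, _ => 0
      end
  | _, _ => 0
  end.

(* The factor 1/2 applies to the horizontal neighbours only. *)
Definition ME (R : realType) (n m : nat) (B : 'M[R]_(n, m)) : R :=
  2^-1 * (\sum_(k < n) \sum_(l < m)
            B k l * (entry B k%:Z (l%:Z + 1) + entry B k%:Z (l%:Z - 1)))
  + \sum_(k < n) \sum_(l < m)
      B k l * (entry B (k%:Z + 1) l%:Z + entry B (k%:Z - 1) l%:Z).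

(* Only the values of [weight] on adjacent pairs are meaningful. *)
Record wgraph (R : Type) (T : finType) := WGraph {
  adj : rel T;
  weight : T -> T -> R;
  adj_sym : symmetric adj;
  adj_irrefl : irreflexive adj;
  weight_sym : forall x y, weight x y = weight y x
}.

Lemma neq_sym (T : finType) : symmetric (fun x y : T => x != y).
Proof. by move=> x y; rewrite eq_sym. Qed.

Lemma neq_irrefl (T : finType) : irreflexive (fun x y : T => x != y).
Proof. by move=> x; rewrite eqxx. Qed.

Definition complete_wgraph (R : Type) (T : finType) (w : T -> T -> R)
    (w_sym : forall x y, w x y = w y x) : wgraph R T :=
  WGraph (@neq_sym T) (@neq_irrefl T) w_sym.

(* A path is given by its sequence of vertices; a path and its reversal have
   the same weight, so orienting paths does not affect maximality. *)
Definition hamiltonian_path (R : Type) (T : finType) (G : wgraph R T)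
    (p : seq T) : Prop :=
  [/\ sorted (adj G) p, uniq p & forall x : T, x \in p].

Definition path_weight (R : nmodType) (T : finType) (G : wgraph R T)
    (p : seq T) : R :=
  \sum_(e <- zip p (behead p)) weight G e.1 e.2.

Definition max_weight_hamiltonian_path (R : realType) (T : finType)
    (G : wgraph R T) (p : seq T) : Prop :=
  hamiltonian_path G p /\
  forall q : seq T, hamiltonian_path G q -> path_weight G q <= path_weight G p.

Definition induced_path (s : nat) (sigma : 'S_s) : seq 'I_s :=
  [seq (sigma^-1)%g k | k <- enum 'I_s].

Definition omegaME (R : realType) (n m : nat) (A : 'M[R]_(n, m))
    (i k : 'I_n) : R :=
  \sum_(j < m) A i j * A k j.

Definition tauME (R : realType) (n m : nat) (A : 'M[R]_(n, m))
    (j l : 'I_m) : R :=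
  \sum_(i < n) A i j * A i l.

Lemma omegaME_sym (R : realType) (n m : nat) (A : 'M[R]_(n, m)) i k :
  omegaME A i k = omegaME A k i.
Proof. by apply: eq_bigr => j _; rewrite mulrC. Qed.

Lemma tauME_sym (R : realType) (n m : nat) (A : 'M[R]_(n, m)) j l :
  tauME A j l = tauME A l j.
Proof. by apply: eq_bigr => i _; rewrite mulrC. Qed.

Definition row_graph (R : realType) (n m : nat) (A : 'M[R]_(n, m)) :
    wgraph R 'I_n :=
  complete_wgraph (omegaME_sym A).

Definition col_graph (R : realType) (n m : nat) (A : 'M[R]_(n, m)) :
    wgraph R 'I_m :=
  complete_wgraph (tauME_sym A).

(* Main.v *)
Require Import Defs.
From mathcomp Require Import all_boot all_order all_fingroup all_algebra.
From mathcomp Require Import reals.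
Import GRing.Theory Num.Theory.
Local Open Scope ring_scope.

(** The measure of effectiveness separates into a column term and a row term.
    In a fixed row, summing each entry times its two horizontal neighbours
    counts every adjacent pair of positions twice
    ([sum_mul_neighbours]).  Summing these products over all rows turns
    each adjacent pair of columns into an inner product of columns, that is, a
    [tauME] weight, and an inner product does not see the order in which the
    rows are listed ([tauME_reorder]).  Hence the horizontal part of the
    measure of a reordered matrix depends on the column permutation alone and
    is twice the weight of the path that it induces; by transposition the
    vertical part is twice the weight of the path induced by the row
    permutation.  With the factor 1/2 on the horizontal part,
      ME = weight of the column path + 2 * weight of the row path
    ([ME_reorder]).

    As both coefficients are positive and the two permutations vary
    independently, the sum is maximal exactly when each weight is maximal among
    induced paths.  In a complete graph the Hamiltonian paths are precisely the
    orderings of the vertex set, and each of them is induced by a permutation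
    ([hamiltonian_path_induced]), so maximality among induced paths is
    maximality among all Hamiltonian paths. *)

Lemma zip_behead_map (S T : Type) (f : S -> T) (s : seq S) :
  zip (map f s) (behead (map f s))
  = [seq (f e.1, f e.2) | e <- zip s (behead s)].
Proof. by elim: s => [|x [|y s] IHs] //=; congr (_ :: _). Qed.

(** Every pair of consecutive positions is met twice, once from each end:
    neighbours to the left are neighbours to the right with the two factors
    exchanged. *)
Lemma sum_mul_neighbours (R : comNzRingType) (r : seq R) :
  \sum_(i < size r) r`_i * (r`_i.+1 + (if i : nat is i'.+1 then r`_i' else 0))
  = 2 * \sum_(e <- zip r (behead r)) e.1 * e.2.
Proof.
have right_nb: \sum_(i < size r) r`_i * r`_i.+1
    = \sum_(e <- zip r (behead r)) e.1 * e.2.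
  elim: r => [|x [|y r] IHr] /=; first by rewrite big_ord0 big_nil.
    by rewrite big_ord1 mulr0 big_nil.
  by rewrite big_ord_recl big_cons -IHr.
have left_nb: \sum_(i < size r) r`_i * (if i : nat is i'.+1 then r`_i' else 0)
    = \sum_(i < size r) r`_i * r`_i.+1.
  case: r {right_nb} => [|x r]; first by rewrite !big_ord0.
  (* The first position has no left neighbour; the last has a zero right one. *)
  rewrite big_ord_recl mulr0 add0r big_ord_recr /= (@nth_default _ _ r) // mulr0 addr0.
  by apply: eq_bigr => i _; rewrite mulrC.
under eq_bigr do rewrite mulrDr.
by rewrite big_split left_nb right_nb mulr_natl mulr2n.
Qed.

Lemma entry_row (R : realType) (n m : nat) (B : 'M[R]_(n, m)) (k : 'I_n)
    (l : nat) :
  entry B k%:Z l%:Z = [seq B k j | j <- enum 'I_m]`_l.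
Proof.
rewrite /entry valK; case: insubP => [j _ <-|]; last first.
  by rewrite -leqNgt => le_ml; rewrite nth_default // size_map size_enum_ord.
by rewrite (nth_map j) ?size_enum_ord //= nth_ord_enum.
Qed.

Lemma entry_tr (R : realType) (n m : nat) (B : 'M[R]_(n, m)) (k l : int) :
  entry B^T l k = entry B k l.
Proof.
case: k l => k [l|l] //=.
by case: insubP => [j _ _|_]; case: insubP => [i _ _|_] //; rewrite mxE.
Qed.

(** Exchanging the sum over the rows with the sum over adjacent pairs of
    columns makes the inner products of columns appear. *)
Lemma horizontal_ME (R : realType) (n m : nat) (B : 'M[R]_(n, m)) :
  \sum_(k < n) \sum_(l < m)
     B k l * (entry B k%:Z (l%:Z + 1) + entry B k%:Z (l%:Z - 1))
  = 2 * \sum_(e <- zip (enum 'I_m) (behead (enum 'I_m))) tauME B e.1 e.2.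
Proof.
rewrite /tauME [in RHS]exchange_big mulr_sumr.
apply: eq_bigr => k _.
set r := [seq B k j | j <- enum 'I_m].
have size_r : size r = m by rewrite size_map size_enum_ord.
have := sum_mul_neighbours _ r.
rewrite size_r /r zip_behead_map big_map => <-.
apply: eq_bigr => l _.
have -> : l%:Z + 1 = l.+1%:Z by rewrite -addn1 PoszD.
rewrite !entry_row.
congr (_ * (_ + _)); first by rewrite (nth_map l) ?size_enum_ord // nth_ord_enum.
case: (val l) => [|l'] //.
by rewrite -addn1 PoszD addrK entry_row.
Qed.

Lemma vertical_ME (R : realType) (n m : nat) (B : 'M[R]_(n, m)) :
  \sum_(k < n) \sum_(l < m)
     B k l * (entry B (k%:Z + 1) l%:Z + entry B (k%:Z - 1) l%:Z)
  = 2 * \sum_(e <- zip (enum 'I_n) (behead (enum 'I_n))) omegaME B e.1 e.2.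
Proof.
have tauME_tr i k : tauME B^T i k = omegaME B i k.
  by apply: eq_bigr => j _; rewrite !mxE.
rewrite exchange_big -(eq_bigr _ (fun e _ => tauME_tr e.1 e.2)) -horizontal_ME.
by do 2!apply: eq_bigr => ? _; rewrite !mxE !entry_tr.
Qed.

(** An inner product of two columns is invariant under permuting the rows, so
    the row permutation disappears. *)
Lemma tauME_reorder (R : realType) (n m : nat) (A : 'M[R]_(n, m))
    (sr : 'S_n) (sc : 'S_m) (j l : 'I_m) :
  tauME (reorder A sr sc) j l = tauME A ((sc^-1)%g j) ((sc^-1)%g l).
Proof.
rewrite /tauME (reindex_inj (@perm_inj _ sr)).
by apply: eq_bigr => i _; rewrite !mxE permK.
Qed.

Lemma omegaME_reorder (R : realType) (n m : nat) (A : 'M[R]_(n, m))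
    (sr : 'S_n) (sc : 'S_m) (i k : 'I_n) :
  omegaME (reorder A sr sc) i k = omegaME A ((sr^-1)%g i) ((sr^-1)%g k).
Proof.
rewrite /omegaME (reindex_inj (@perm_inj _ sc)).
by apply: eq_bigr => j _; rewrite !mxE permK.
Qed.

Lemma path_weight_induced (R : realType) (s : nat) (G : wgraph R 'I_s)
    (sigma : 'S_s) :
  path_weight G (induced_path sigma)
  = \sum_(e <- zip (enum 'I_s) (behead (enum 'I_s)))
      weight G ((sigma^-1)%g e.1) ((sigma^-1)%g e.2).
Proof. by rewrite /path_weight /induced_path zip_behead_map big_map. Qed.

(** The two permutations contribute independently; the factor 1/2 halves the
    double count of the horizontal pairs but leaves that of the vertical ones. *)
Lemma ME_reorder (R : realType) (n m : nat) (A : 'M[R]_(n, m))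
    (sr : 'S_n) (sc : 'S_m) :
  ME (reorder A sr sc) = path_weight (col_graph A) (induced_path sc)
                         + 2 * path_weight (row_graph A) (induced_path sr).
Proof.
rewrite /ME horizontal_ME vertical_ME mulKf ?pnatr_eq0 // !path_weight_induced.
congr (_ + 2 * _); apply: eq_bigr => e _.
  exact: tauME_reorder.
exact: omegaME_reorder.
Qed.

(** Completeness of the graph makes the adjacency condition a consequence of
    the absence of repetitions, so a Hamiltonian path is just a rearrangement
    of the list of all vertices. *)
Lemma hamiltonian_path_induced (R : realType) (s : nat)
    (w : 'I_s -> 'I_s -> R) (w_sym : forall x y, w x y = w y x)
    (p : seq 'I_s) :
  hamiltonian_path (complete_wgraph w_sym) p
  <-> exists sigma : 'S_s, p = induced_path sigma.
Proof.
split=> [[_ uniq_p all_p] | [sigma ->]].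
  have /tuple_permP[t def_p] : perm_eq p (ord_tuple s).
    by apply: uniq_perm; rewrite ?enum_uniq // => x; rewrite all_p mem_enum.
  (* The permutation [t] sends positions to vertices, whereas the permutation
     inducing a path sends vertices to positions. *)
  exists (t^-1)%g; rewrite {}def_p /induced_path invgK /=.
  by apply: eq_map => i; rewrite tnth_ord_tuple.
have uniq_sigma : uniq (induced_path sigma).
  by rewrite map_inj_uniq ?enum_uniq //; apply: perm_inj.
split=> // [|x].
  by apply: pairwise_sorted; rewrite -uniq_pairwise.
by apply/mapP; exists (sigma x); rewrite ?mem_enum ?permK.
Qed.

Lemma max_weight_induced (R : realType) (s : nat)
    (w : 'I_s -> 'I_s -> R) (w_sym : forall x y, w x y = w y x)
    (sigma : 'S_s) (G := complete_wgraph w_sym) :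
  max_weight_hamiltonian_path G (induced_path sigma)
  <-> forall sigma' : 'S_s,
        path_weight G (induced_path sigma')
        <= path_weight G (induced_path sigma).
Proof.
split=> [[_ max_sigma] sigma' | max_sigma].
  by apply: max_sigma; apply/hamiltonian_path_induced; exists sigma'.
split=> [|q /hamiltonian_path_induced[sigma' ->] //].
by apply/hamiltonian_path_induced; exists sigma.
Qed.

Theorem theorem2 (R : realType) (n m : nat) (A : 'M[R]_(n, m))
    (sr : 'S_n) (sc : 'S_m) :
  (forall (sr' : 'S_n) (sc' : 'S_m),
     ME (reorder A sr' sc') <= ME (reorder A sr sc)) <->
  max_weight_hamiltonian_path (row_graph A) (induced_path sr) /\
  max_weight_hamiltonian_path (col_graph A) (induced_path sc).
Proof.
rewrite !max_weight_induced; split=> [max_ME | [max_sr max_sc] sr' sc'].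
  (* Varying one permutation and keeping the other isolates one weight. *)
  split=> [sr' | sc'].
    by have := max_ME sr' sc; rewrite !ME_reorder lerD2l ler_pM2l ?ltr0n.
  by have := max_ME sr sc'; rewrite !ME_reorder lerD2r.
by rewrite !ME_reorder lerD ?ler_pM2l ?ltr0n.
Qed.
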